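(* Let $(y_n)_{n\ge 1}$ be a nondecreasing sequence of positive integers with output array $A(n,k)$. Fix a positive integer $n$, and let $K$ denote the largest integer $m\ge 0$ for which $A(n+1,m+1)>0$. Suppose $k\ge 0$ is an integer with $k+1\le K$. Then $$A(n+1,k+1)=A(n+1,k)+A(n,k+1)$$ and $$A(n+1,k+1)=\sum_{j=0}^{k+1}A(n,j).$$
   Context: Let $(y_n)_{n\ge1}$ be a nondecreasing sequence of positive integers (an input sequence). For a positive integer $n$, an $n$-tuple $\mathbf{x}=(x_1,\dots,x_n)$ of nonnegative integers is called valid for $(y_n)$ if $x_1\le y_n$ and $x_{j+1}\le \min(x_j,y_{n-j})$ for $1\le j\le n-1$. For $n\ge1$ and $k\ge0$, $A(n,k)$ denotes the number of valid $n$-tuples with $x_1=k$; the array $(A(n,k))$ is the output array of $(y_n)$. *)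

(* Defs.v *)
From mathcomp Require Import all_boot.
Set Implicit Arguments.
Unset Strict Implicit.
Unset Printing Implicit Defensive.

(* Sequences are indexed from 1: the value [y 0] is never constrained or used. *)
Definition input_sequence (y : nat -> nat) : Prop :=
  (forall i, 0 < i -> 0 < y i) /\
  (forall i j, 0 < i -> i <= j -> y i <= y j).

(* [entry x j] is x_j, with 1 <= j <= n. *)
Definition entry n (x : n.-tuple nat) (j : nat) : nat := nth 0 x j.-1.

Definition valid (y : nat -> nat) n (x : n.-tuple nat) : bool :=
  (entry x 1 <= y n) &&
  [forall j : 'I_n, (1 <= j) ==>
     (entry x j.+1 <= minn (entry x j) (y (n - j)))].

(* The entries of a valid n-tuple are all at most y n, so the valid tuples are
   counted among the tuples over 'I_(y n).+1; [output_array_count] shows that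
   this bound loses nothing.  Only n >= 1 is meaningful. *)
Definition output_array (y : nat -> nat) (n k : nat) : nat :=
  #|[set x : n.-tuple 'I_(y n).+1 |
      valid y (map_tuple val x) & entry (map_tuple val x) 1 == k]|.

Lemma valid_le y n (x : n.-tuple nat) :
  valid y x -> all (fun a => a <= y n) x.
Proof.
case/andP=> x1 /forallP vx; apply/(all_nthP 0) => i; rewrite size_tuple.
elim: i => [|i IHi] lt_in; first exact: x1.
have := vx (Ordinal lt_in); rewrite /= leq_min => /andP[le_x _].
by apply: leq_trans le_x _; apply: IHi; apply: ltnW.
Qed.

Lemma output_array_count y n k (s : seq (n.-tuple nat)) :
  uniq s -> (forall x, (x \in s) = valid y x && (entry x 1 == k)) ->
  output_array y n k = size s.
Proof.
move=> s_uniq s_mem; rewrite /output_array cardE.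
have inj_val : injective (fun x : n.-tuple 'I_(y n).+1 => map_tuple val x).
  by move=> x x' /(congr1 val) /= /(inj_map val_inj) /val_inj.
rewrite -(size_map (fun x : n.-tuple 'I_(y n).+1 => map_tuple val x)).
apply: perm_size; apply: uniq_perm => //; first by rewrite map_inj_uniq ?enum_uniq.
move=> x; rewrite s_mem; apply/mapP/idP => [[u]|/andP[vx x1]].
  by rewrite mem_enum inE => vu ->.
pose u := map_tuple (fun a => inord a : 'I_(y n).+1) x.
have ux : x = map_tuple val u.
  apply: val_inj; rewrite /= -map_comp -[LHS]map_id.
  apply/eq_in_map => a /(allP (valid_le vx)) le_a.
  by rewrite /= inordK.
by exists u; rewrite // mem_enum inE -ux vx.
Qed.

(* Main.v *)
Require Import Defs.
From mathcomp Require Import all_boot.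

(* Deleting the first entry of a valid (n+1)-tuple leaves a valid n-tuple, and
   m followed by a valid n-tuple x is valid iff x_1 <= m <= y_(n+1).  Hence
   A(n+1,m) = A(n,0) + ... + A(n,m) whenever m <= y_(n+1).  The hypothesis on K
   gives k + 1 < K + 1 <= y_(n+1), so this applies to both m = k and m = k + 1,
   and subtracting the two sums gives the recurrence. *)

(** Since (n+1)-(j+1) = n-j, constraint j+1 on the longer tuple is constraint j on [x]. Constraint
    1, present because [0 < n], gives both x_1 <= m and the leading bound x_1 <= y_n. *)
Lemma valid_cons (y : nat -> nat) (n m : nat) (x : n.-tuple nat) :
  0 < n ->
  valid y (cons_tuple m x) = [&& m <= y n.+1, entry x 1 <= m & valid y x].
Proof.
move=> n_gt0; rewrite /valid {1}/entry /=; congr (_ && _).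
apply/forallP/and3P => [vx|[le_x1 le_x1y /forallP vx] [[|[|j]] lt_j]] //=.
- have := vx (Ordinal (n_gt0 : 1 < n.+1)).
  rewrite /entry /= subn1 leq_min => /andP[-> ->]; split=> //.
  apply/forallP => -[[|j] lt_j] //=.
  by have := vx (Ordinal (lt_j : j.+2 < n.+1)); rewrite /entry /= subSS.
- by rewrite /entry /= subn1 leq_min; apply/andP.
- by have := vx (Ordinal (lt_j : j.+1 < n)); rewrite /entry /= subSS.
Qed.

(** The bound in ['I_(y n).+1] changes with [n]; a list of plain [nat] tuples can be extended to
    length n+1 without changing the entry type. *)
Lemma valid_enumeration (y : nat -> nat) (n : nat) :
  {s : seq (n.-tuple nat) | uniq s & s =i valid y (n := n)}.
Proof.
pose f (u : n.-tuple 'I_(y n).+1) : n.-tuple nat := map_tuple val u.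
have inj_f : injective f.
  by move=> u v /(congr1 val) /= /(inj_map val_inj) /val_inj.
exists [seq f u | u <- enum [pred u | valid y (f u)]].
  by rewrite map_inj_uniq ?enum_uniq.
move=> x; apply/mapP/idP => [[u]|vx]; first by rewrite mem_enum => vu ->.
(* By [valid_le] no entry exceeds y_n, so [inord] preserves every entry. *)
pose u : n.-tuple 'I_(y n).+1 := map_tuple inord x.
have xE : x = f u.
  apply: val_inj; rewrite /= -map_comp -[LHS]map_id.
  by apply/eq_in_map => a /(allP (valid_le vx)) le_a; rewrite /= inordK.
by exists u; rewrite // mem_enum inE -xE.
Qed.

Lemma count_leq_sum (T : Type) (f : T -> nat) (s : seq T) (m : nat) :
  count (fun x => f x <= m) s =
  \sum_(0 <= j < m.+1) count (fun x => f x == j) s.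
Proof.
elim: m => [|m IHm].
  by rewrite big_nat1; apply: eq_count => x; rewrite leqn0.
(* The events f x <= m and f x = m+1 are disjoint, so the intersection term vanishes. *)
rewrite big_nat_recr //= -IHm -count_predUI [X in _ + X](@eq_count _ _ pred0).
  rewrite count_pred0 addn0; apply: eq_count => x /=.
  by rewrite leq_eqVlt ltnS orbC.
by move=> x /=; case: eqP => [->|]; rewrite ?ltnn ?andbF.
Qed.

Lemma output_array_recS (y : nat -> nat) (n m : nat) :
  0 < n -> m <= y n.+1 ->
  output_array y n.+1 m = \sum_(0 <= j < m.+1) output_array y n j.
Proof.
move=> n_gt0 le_my; have [s s_uniq s_mem] := valid_enumeration y n.
have Aj j : output_array y n j = count (fun x => entry x 1 == j) s.
  rewrite -size_filter; apply: output_array_count => [|x].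
    exact: filter_uniq.
  by rewrite mem_filter s_mem andbC.
under eq_bigr do rewrite Aj.
(* The sum becomes the length of an explicit list: [m] prepended to each tuple of [s] with first
   entry at most [m]. *)
rewrite -count_leq_sum -size_filter -(size_map (fun x => cons_tuple m x)).
have inj_cons : injective (fun x : n.-tuple nat => cons_tuple m x).
  by move=> x x' /(congr1 val) [] /val_inj.
apply: output_array_count => [|x].
  by rewrite map_inj_uniq // filter_uniq.
case/tupleP: x => a x; rewrite valid_cons // {2}/entry /=.
apply/mapP/andP => [[x']|[/and3P[_ le_x1 vx] /eqP a_m]].
  rewrite mem_filter s_mem => /andP[le_x1 vx] /(congr1 val) [-> /val_inj ->].
  by rewrite le_my le_x1 eqxx.
by exists x; rewrite ?mem_filter ?s_mem -a_m ?le_x1.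
Qed.

Lemma output_array_gt0_leq (y : nat -> nat) (n k : nat) :
  0 < output_array y n k -> k <= y n.
Proof.
by case/card_gt0P => x; rewrite inE => /andP[/andP[le_x1 _] /eqP <-].
Qed.

Theorem theorem2p2 (y : nat -> nat) (hy : input_sequence y)
    (n : nat) (hn : 0 < n) (K : nat)
    (hK : 0 < output_array y (n + 1) (K + 1))
    (hKmax : forall m : nat, 0 < output_array y (n + 1) (m + 1) -> m <= K)
    (k : nat) (hk : k + 1 <= K) :
  output_array y (n + 1) (k + 1) =
    output_array y (n + 1) k + output_array y n (k + 1) /\
  output_array y (n + 1) (k + 1) = \sum_(0 <= j < k.+2) output_array y n j.
Proof.
move/output_array_gt0_leq: hK; move: hk; rewrite !addn1 => lt_kK lt_Ky.
have lt_ky : k < y n.+1 by apply: ltn_trans lt_kK lt_Ky.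
(* Both rows at n+1 become partial sums of row n, differing only in the term j = k+1. *)
rewrite !output_array_recS ?(ltnW lt_ky) //.
by split=> //; rewrite big_nat_recr.
Qed.
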